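(* There exists a graph $G$ whose girth is equal to $5$ that does not have the AOP property.
   Context: All graphs are finite, simple and undirected. The girth of a graph is the length of a shortest cycle in it. An orientation of $G$ assigns exactly one direction to each edge; it is acyclic if it has no directed cycle. A graph $G$ has the AOP (acyclic one path) property if it has an acyclic orientation such that there is at most one directed path between any two vertices, i.e. for all distinct vertices $u,v$ there is at most one directed path from $u$ to $v$. *)

(* Defs.v *)
From mathcomp Require Import all_boot.

Set Implicit Arguments.
Unset Strict Implicit.
Unset Printing Implicit Defensive.

Record sgraph := SGraph {
  vertex :> finType;
  adj : rel vertex;
  adj_sym : symmetric adj;
  adj_irr : irreflexive adj
}.

(* The size condition excludes the closed walk [:: x; y] along a single edge,
   for which ucycle holds. *)
Definition graph_cycle (G : sgraph) (c : seq G) : Prop :=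
  2 < size c /\ ucycle (@adj G) c.

(* A forest has no girth in this sense (conventionally it is infinite). *)
Definition has_girth (G : sgraph) (g : nat) : Prop :=
  (exists2 c : seq G, graph_cycle c & size c = g) /\
  (forall c : seq G, graph_cycle c -> g <= size c).

(* d x y means that the edge xy is directed from x to y. *)
Definition orientation (G : sgraph) (d : rel G) : Prop :=
  subrel d (@adj G) /\ (forall x y : G, adj x y -> d x y (+) d y x).

Definition acyclic (T : eqType) (d : rel T) : Prop :=
  forall c : seq T, c <> [::] -> ~ ucycle d c.

(* The vertices of the path are u :: p, in this order. *)
Definition directed_path (T : eqType) (d : rel T) (u v : T) (p : seq T) : Prop :=
  [/\ path d u p, last u p = v & uniq (u :: p)].

Definition AOP (G : sgraph) : Prop :=
  exists d : rel G,
    [/\ orientation d, acyclic d &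
        forall u v : G, u <> v -> forall p q : seq G,
          directed_path d u v p -> directed_path d u v q -> p = q].

(* Main.v *)
(* In an acyclic orientation with at most one directed path between any two
   vertices, no cycle is the union of two directed paths with common ends, so
   the direction changes at least four times around each cycle.  Around a
   5-cycle it therefore changes exactly four times: exactly one vertex of the
   5-cycle is passed through, the others being sources or sinks of it.
   The Hoffman-Singleton graph consists of pentagons P_h and pentagrams Q_i
   (h, i in Z/5), the vertex j of P_h being joined to the vertex hi + j of Q_i.
   The subgraph induced on P_0, P_1, Q_0, Q_1, Q_2 has girth 5 and is so rich in
   5-cycles that no orientation satisfies this condition on all of them, which
   a backtracking search over the orientations of its 55 edges confirms. *)

Require Import Defs.
From mathcomp Require Import all_boot.

Set Implicit Arguments.
Unset Strict Implicit.
Unset Printing Implicit Defensive.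

Definition through (T : Type) (d : rel T) (x y z : T) : bool :=
  d x y && d y z || d z y && d y x.

(* In an oriented 5-cycle this number is odd, so that the condition of being
   exactly one is an upper bound, which is inherited by partial orientations. *)
Definition nthrough (T : Type) (d : rel T) (c : seq T) : nat :=
  if c is [:: x0; x1; x2; x3; x4] then
    through d x0 x1 x2 + through d x1 x2 x3 + through d x2 x3 x4
    + through d x3 x4 x0 + through d x4 x0 x1
  else 0.

Lemma nthrough_map (T U : Type) (f : T -> U) (d : rel U) (c : seq T) :
  nthrough (relpre f d) c = nthrough d (map f c).
Proof. by case: c => [|? [|? [|? [|? [|? [|? ?]]]]]]. Qed.

Lemma leq_nthrough (T : Type) (d d' : rel T) (c : seq T) :
  subrel d d' -> nthrough d c <= nthrough d' c.
Proof.
move=> sdd'; case: c => [|x0 [|x1 [|x2 [|x3 [|x4 [|? ?]]]]]] //=.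
have le_through x y z : through d x y z <= through d' x y z.
  rewrite /through; case: (boolP (_ || _)) => //.
  by case/orP => /andP[/sdd' -> /sdd' ->]; rewrite ?orbT.
by rewrite !leq_add.
Qed.

(** * Constraints on the orientation of one 5-cycle *)

Section UniquePathOrientation.

Variables (G : sgraph) (d : rel G).
Hypotheses (d_orient : orientation d) (d_acyclic : acyclic d).
Hypothesis d_unique : forall u v : G, u <> v -> forall p q : seq G,
  directed_path d u v p -> directed_path d u v q -> p = q.

Lemma orientationN (x y : G) : adj x y -> d y x = ~~ d x y.
Proof. by move=> /(proj2 d_orient); case: (d x y); case: (d y x). Qed.

(** Either direction of the fifth edge is fatal: it closes a directed cycle or is a second path from
    [x0] to [x4]. *)
Lemma pentagon_no_path4 (x0 x1 x2 x3 x4 : G) :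
    uniq [:: x0; x1; x2; x3; x4] -> adj x4 x0 ->
  ~~ [&& d x0 x1, d x1 x2, d x2 x3 & d x3 x4].
Proof.
move=> Ux /(proj2 d_orient) d40; apply/and4P => -[d01 d12 d23 d34].
case: (boolP (d x4 x0)) => [d4 | nd4].
  apply: (d_acyclic (c := [:: x0; x1; x2; x3; x4])) => //.
  by rewrite /ucycle /= d01 d12 d23 d34 d4.
have d04 : d x0 x4 by move: d40; rewrite (negPf nd4).
have nx04 : x0 <> x4 by move=> x04; move: Ux; rewrite x04 /= !inE eqxx !orbT.
suff: [:: x4] = [:: x1; x2; x3; x4] by [].
apply: (d_unique nx04); split=> //=; rewrite ?d04 ?d01 ?d12 ?d23 ?d34 //.
by rewrite inE (introF eqP nx04).
Qed.

Lemma pentagon_no_path23 (x0 x1 x2 x3 x4 : G) :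
    uniq [:: x0; x1; x2; x3; x4] ->
  ~~ [&& d x0 x1, d x1 x2, d x0 x4, d x4 x3 & d x3 x2].
Proof.
move=> Ux; apply/and5P => -[d01 d12 d04 d43 d32].
have nx02 : x0 <> x2 by move=> x02; move: Ux; rewrite x02 /= !inE eqxx !orbT.
suff: [:: x1; x2] = [:: x4; x3; x2] by [].
apply: (d_unique nx02); split=> //=; rewrite ?d01 ?d12 ?d04 ?d43 ?d32 //.
  exact: subseq_uniq (prefix_subseq [:: x0; x1; x2] [:: x3; x4]) Ux.
have Ur : uniq [:: x0; x4; x3; x2; x1].
  rewrite -(perm_uniq (s1 := [:: x0; x1; x2; x3; x4])) //.
  by rewrite perm_cons -(perm_rev [:: x1; x2; x3; x4]).
exact: subseq_uniq (prefix_subseq [:: x0; x4; x3; x2] [:: x1]) Ur.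
Qed.

(** On a 5-cycle the count is odd. Five means a directed cycle; three means one source and one sink,
    joined by paths of lengths 1 and 4, or 2 and 3. *)
Lemma nthrough_pentagon (c : seq G) : ucycle (@adj G) c -> nthrough d c <= 1.
Proof.
case: c => [|x0 [|x1 [|x2 [|x3 [|x4 [|? ?]]]]]] //.
rewrite /ucycle => /andP[/= /and5P[a01 a12 a23 a34 /andP[a40 _]] Ux].
have rotU n : uniq (rot n [:: x0; x1; x2; x3; x4]) by rewrite rot_uniq.
have revU n : uniq (rot n (rev [:: x0; x1; x2; x3; x4])).
  by rewrite rot_uniq rev_uniq.
have sym (x y : G) : adj x y -> adj y x by rewrite adj_sym.
(* The two exclusions are supplied for all ten rotations and reflections of the 5-cycle; its 32
   orientations are then checked one by one. *)
move: (pentagon_no_path4 (rotU 0) a40) (pentagon_no_path4 (rotU 1) a01)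
  (pentagon_no_path4 (rotU 2) a12) (pentagon_no_path4 (rotU 3) a23)
  (pentagon_no_path4 (rotU 4) a34).
move: (pentagon_no_path4 (revU 0) (sym _ _ a40))
  (pentagon_no_path4 (revU 1) (sym _ _ a34))
  (pentagon_no_path4 (revU 2) (sym _ _ a23))
  (pentagon_no_path4 (revU 3) (sym _ _ a12))
  (pentagon_no_path4 (revU 4) (sym _ _ a01)).
move: (pentagon_no_path23 (rotU 0)) (pentagon_no_path23 (rotU 1))
  (pentagon_no_path23 (rotU 2)) (pentagon_no_path23 (rotU 3))
  (pentagon_no_path23 (rotU 4)).
move: (pentagon_no_path23 (revU 0)) (pentagon_no_path23 (revU 1))
  (pentagon_no_path23 (revU 2)) (pentagon_no_path23 (revU 3))
  (pentagon_no_path23 (revU 4)).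
rewrite /= /through (orientationN a01) (orientationN a12) (orientationN a23).
rewrite (orientationN a34) (orientationN a40).
by case: (d x0 x1); case: (d x1 x2); case: (d x2 x3); case: (d x3 x4);
  case: (d x4 x0).
Qed.

End UniquePathOrientation.

(** * Listing the 5-cycles for the search *)

Section Pentagons.

Variable T : eqType.
Implicit Types es : seq (T * T).

Definition edge_rel es : rel T :=
  fun x y => ((x, y) \in es) || ((y, x) \in es).

Definition neighbours es (x : T) : seq T :=
  [seq e.2 | e <- es & e.1 == x] ++ [seq e.1 | e <- es & e.2 == x].

Lemma mem_neighbours es (x y : T) : (y \in neighbours es x) = edge_rel es x y.
Proof.
rewrite mem_cat; congr (_ || _); apply/mapP/idP.
- by case=> -[u v]; rewrite mem_filter /= => /andP[/eqP-> ?] ->.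
- by move=> xy; exists (x, y); rewrite ?mem_filter ?eqxx.
- by case=> -[u v]; rewrite mem_filter /= => /andP[/eqP-> ?] ->.
- by move=> yx; exists (y, x); rewrite ?mem_filter ?eqxx.
Qed.

Definition pentagons es (e : T * T) : seq (seq T) :=
  flatten [seq [seq [:: e.1, e.2, x & p] | p <-
    [seq [:: y; z] | y <- neighbours es x, z <- neighbours es y]
      & e.1 \in neighbours es (last x p)] | x <- neighbours es e.2].

(** Each 5-cycle is attached to the last of its edges, so it is tested as soon as it is fully
    oriented. *)
Fixpoint search_plan es todo : seq (T * T * seq (seq T)) :=
  if todo is e :: todo' then
    (e, pentagons es e) :: search_plan (e :: es) todo'
  else [::].

End Pentagons.

(** * The backtracking search and its soundness *)

(* The out-neighbours of the vertices 0, 1, ... *)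
Definition arcs : Type := seq (seq nat).

Definition arc_rel (o : arcs) : rel nat := fun x y => y \in nth [::] o x.

Definition add_arc (o : arcs) (x y : nat) : arcs :=
  set_nth [::] o x (y :: nth [::] o x).

Lemma arc_rel_add (o : arcs) (x y u v : nat) :
  arc_rel (add_arc o x y) u v = (u == x) && (v == y) || arc_rel o u v.
Proof.
by rewrite /arc_rel nth_set_nth /=; case: eqP => [-> | //]; rewrite inE.
Qed.

(* [vm_compute] evaluates both arguments of [&&] and [||], hence the [if]s. *)
Fixpoint refuted (plan : seq (nat * nat * seq (seq nat))) (o : arcs) : bool :=
  if plan is ((x, y), cs) :: plan' then
    let refuted_with o' :=
      if has (fun c => 1 < nthrough (arc_rel o') c) cs then true
      else refuted plan' o' in
    if refuted_with (add_arc o x y) then refuted_with (add_arc o y x) else false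
  else false.

(** At each edge, one of the two branches agrees with [d]. Following these branches, [leq_nthrough]
    prevents any listed cycle from failing, so the search reaches the empty plan and returns
    [false]. *)
Lemma refutedP (d : rel nat) (plan : seq (nat * nat * seq (seq nat))) (o : arcs) :
    (forall x y cs, ((x, y), cs) \in plan ->
      d x y || d y x /\ {in cs, forall c, nthrough d c <= 1}) ->
  subrel (arc_rel o) d -> ~~ refuted plan o.
Proof.
elim: plan o => [//|[[x y] cs] plan IHplan] o plan_d od.
have /plan_d[dxy cs_d] : (x, y, cs) \in (x, y, cs) :: plan by rewrite mem_head.
have sound u v : d u v ->
  (if has (fun c => 1 < nthrough (arc_rel (add_arc o u v)) c) cs then true
   else refuted plan (add_arc o u v)) = false.
  move=> duv; have aod : subrel (arc_rel (add_arc o u v)) d.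
    by move=> s t; rewrite arc_rel_add => /orP[/andP[/eqP-> /eqP->] | /od].
  case: hasP => [[c /cs_d c1] | _].
    by rewrite ltnNge (leq_trans (leq_nthrough c aod) c1).
  apply/negbTE/IHplan => // s t cs' plan_cs'.
  by apply: plan_d; rewrite inE plan_cs' orbT.
by case/orP: dxy => /sound /= ->; rewrite ?if_same.
Qed.

(** * The graph on 25 vertices *)

(* The vertex j of the k-th of P_0, P_1, Q_0, Q_1, Q_2 is 5k + j.  The edges are
   listed in an order that completes 5-cycles early, to prune the search. *)
Definition edges : seq (nat * nat) :=
  [:: (0, 1); (0, 4); (1, 2); (2, 3); (3, 4); (0, 15); (2, 17); (15, 17);
      (3, 18); (15, 18); (1, 16); (16, 18); (4, 19); (16, 19); (17, 19);
      (5, 16); (6, 17); (5, 6); (7, 18); (6, 7); (8, 19); (7, 8); (9, 15);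
      (5, 9); (8, 9); (0, 10); (5, 10); (2, 12); (7, 12); (10, 12); (10, 13);
      (3, 13); (8, 13); (11, 13); (6, 11); (1, 11); (11, 14); (12, 14); (4, 14);
      (9, 14); (0, 20); (8, 20); (3, 23); (6, 23); (20, 23); (1, 21); (21, 23);
      (9, 21); (4, 24); (21, 24); (7, 24); (2, 22); (22, 24); (5, 22); (20, 22)].

Definition vertices : seq nat := iota 0 25.

Lemma edges_vertices :
  all (fun e => [&& e.1 \in vertices, e.2 \in vertices & e.1 != e.2]) edges.
Proof. by vm_compute. Qed.

Lemma edge_rel_sym : symmetric (edge_rel edges).
Proof. by move=> x y; rewrite /edge_rel orbC. Qed.

Lemma edge_rel_irr : irreflexive (edge_rel edges).
Proof.
move=> x; rewrite /edge_rel orbb; apply/negP => /(allP edges_vertices).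
by rewrite eqxx !andbF.
Qed.

Lemma edges_no_triangle :
  all (fun x => all (fun y => all (fun z => ~~ edge_rel edges z x)
    (neighbours edges y)) (neighbours edges x)) vertices.
Proof. by vm_compute. Qed.

Lemma edges_no_square :
  all (fun x => all (fun y => all (fun z => (z != x) ==>
      all (fun t => (t != y) ==> ~~ edge_rel edges t x) (neighbours edges z))
    (neighbours edges y)) (neighbours edges x)) vertices.
Proof. by vm_compute. Qed.

Definition hs25 : sgraph :=
  @SGraph 'I_25 (relpre val (edge_rel edges))
    (fun x y => edge_rel_sym (val x) (val y)) (fun x => edge_rel_irr (val x)).

Lemma ucycle_hs25 (c : seq hs25) :
  ucycle (@adj hs25) c = ucycle (edge_rel edges) (map val c).
Proof. by rewrite /ucycle cycle_map map_inj_uniq //; apply: val_inj. Qed.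

Lemma mem_vertices (x : 'I_25) : nat_of_ord x \in vertices.
Proof. by rewrite mem_iota /=. Qed.

Lemma hs25_girth : has_girth hs25 5.
Proof.
split.
  (* The witness is the pentagon P_0. *)
  exists (map inord [:: 0; 1; 2; 3; 4]) => //; split=> //.
  rewrite ucycle_hs25 -map_comp (_ : map _ _ = [:: 0; 1; 2; 3; 4]) //.
  by rewrite map_id_in // => i; rewrite !inE /= => i5; rewrite inordK //;
     case/or4P: i5 => [||| /orP[]] /eqP->.
move=> c [c2]; rewrite ucycle_hs25 leqNgt => Uc; apply/negP.
case: c c2 Uc => [|x [|y [|z [|t [|? ?]]]]] // _ /andP[/=].
  rewrite -!mem_neighbours => /and4P[xy yz zx _] _.
  have /allP/(_ _ xy)/allP/(_ _ yz) := allP edges_no_triangle _ (mem_vertices x).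
  by rewrite -mem_neighbours zx.
rewrite -!mem_neighbours !inE !negb_or -!andbA => /and5P[xy yz zt tx _].
case/and5P => _ xz _ _ /and3P[yt _ _].
have /allP/(_ _ xy)/allP/(_ _ yz) := allP edges_no_square _ (mem_vertices x).
move/implyP; rewrite [_ == _]eq_sym => /(_ xz)/allP/(_ _ zt)/implyP.
by rewrite [_ == _]eq_sym -mem_neighbours tx => /(_ yt).
Qed.

(** Computation certifies that the listed walks are 5-cycles of the graph or at least cycles in it,
    in place of a correctness proof for [pentagons] and [search_plan]. *)
Lemma edges_refutation : exists2 plan,
    all (fun ec => (ec.1 \in edges) && all (fun c =>
      all (mem vertices) c && ucycleb (edge_rel edges) c) ec.2) plan &
    refuted plan [::].
Proof. by exists (search_plan [::] edges); vm_compute. Qed.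

Lemma hs25_not_AOP : ~ AOP hs25.
Proof.
case=> d [d_orient d_acyclic d_unique].
have inordV x : x \in vertices -> val (inord x : 'I_25) = x.
  by rewrite mem_iota => /inordK.
have [plan /allP plan_ok] := edges_refutation; apply/negP.
(* The orientation is pulled back to numbers along [inord]; the search starts with no arcs, hence
   inside any relation. *)
apply: (refutedP (d := relpre inord d)) => [x y cs|]; last first.
  by move=> x y; rewrite /arc_rel nth_nil.
move/plan_ok => /andP[/= xy_e cs_ok]; split=> [|c].
  have /and3P[/= xV yV _] := allP edges_vertices _ xy_e.
  have /(proj2 d_orient) : @adj hs25 (inord x) (inord y).
    by rewrite /= !inordV // /edge_rel xy_e.
  by case: (d _ _).
move/(allP cs_ok) => /andP[/allP cV Uc]; rewrite nthrough_map.
apply: (nthrough_pentagon (G := hs25) d_orient d_acyclic d_unique).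
by rewrite ucycle_hs25 -map_comp map_id_in // => z /cV /inordV.
Qed.

Theorem theorem17 : exists G : sgraph, has_girth G 5 /\ ~ AOP G.
Proof. by exists hs25; split; [apply: hs25_girth | apply: hs25_not_AOP]. Qed.
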